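(* Let $$m^*=\frac{2\sqrt3+9}{18\sqrt3-15}.$$ For $m=m^*$, the Hessian of $\sqrt{2I}\,U$ at $z_0=\left(1,0,-\frac12,\frac{\sqrt3}{2},-\frac12,-\frac{\sqrt3}{2},0,0\right)$, whose eigenvalues counted with multiplicity have the form $0,0,\lambda_3,\lambda_3,\lambda_4,\lambda_4,\lambda_5,\lambda_5$, has exactly one of $\lambda_3,\lambda_4,\lambda_5$ equal to zero. Consequently, for $m=m^*$, $z_0$ is a degenerate central configuration of the 4-body problem.
   Context: Consider the planar Newtonian 4-body problem with three masses equal to $1$ at positions $(x_i,y_i)\in\mathbb{R}^2$, $i=1,2,3$, and a fourth mass $m>0$ at position $(x_4,y_4)\in\mathbb{R}^2$. Write $z=(x_1,y_1,x_2,y_2,x_3,y_3,x_4,y_4)\in\mathbb{R}^8$, and let $$I(z)=\frac12\left(\sum_{i=1}^3(x_i^2+y_i^2)+m(x_4^2+y_4^2)\right),$$ $$U(z)=\sum_{1\le i<j\le 3}\frac{1}{\sqrt{(x_i-x_j)^2+(y_i-y_j)^2}}+m\sum_{i=1}^3\frac{1}{\sqrt{(x_i-x_4)^2+(y_i-y_4)^2}} .$$ Central configurations are critical points of $\sqrt{I}\,U$ (equivalently of $\sqrt{2I}\,U$); $z_0$ is one for every $m>0$. Rotation and scaling invariance account for two zero eigenvalues of the Hessian (the $8\times8$ matrix of second partial derivatives with respect to $z$) at a central configuration. A central configuration is called degenerate if the Hessian of $\sqrt{2I}\,U$ there has more than two zero eigenvalues (counted with multiplicity). By the $S_3$ symmetry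 of the configuration, the eigenvalues of the Hessian at $z_0$ are of the form $0,0,\lambda_3,\lambda_3,\lambda_4,\lambda_4,\lambda_5,\lambda_5$. *)

(* Defs.v *)
From HB Require Import structures.
From mathcomp Require Import all_boot all_order all_algebra.
From mathcomp Require Import all_classical all_reals all_analysis.

Set Implicit Arguments.
Unset Strict Implicit.
Unset Printing Implicit Defensive.

Import Order.TTheory GRing.Theory Num.Theory.
Import numFieldNormedType.Exports.

Local Open Scope classical_set_scope.
Local Open Scope ring_scope.

(* Bodies are numbered from 0: bodies 0, 1, 2 have mass 1 and body 3 has mass
   [m]. The configuration [z] lists x_0, y_0, x_1, y_1, x_2, y_2, x_3, y_3. *)
Definition xpos (R : realType) (z : 'rV[R]_8) (i : nat) : R :=
  z ord0 (inord (2 * i)).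

Definition ypos (R : realType) (z : 'rV[R]_8) (i : nat) : R :=
  z ord0 (inord (2 * i + 1)).

Definition dist (R : realType) (z : 'rV[R]_8) (i j : nat) : R :=
  Num.sqrt ((xpos z i - xpos z j) ^+ 2 + (ypos z i - ypos z j) ^+ 2).

Definition inertia (R : realType) (m : R) (z : 'rV[R]_8) : R :=
  2^-1 * (\sum_(i < 3) (xpos z i ^+ 2 + ypos z i ^+ 2)
          + m * (xpos z 3 ^+ 2 + ypos z 3 ^+ 2)).

Definition potential (R : realType) (m : R) (z : 'rV[R]_8) : R :=
  \sum_(i < 3) \sum_(j < 3 | (i < j)%N) (dist z i j)^-1
  + m * \sum_(i < 3) (dist z i 3)^-1.

Definition sqrtIU (R : realType) (m : R) (z : 'rV[R]_8) : R :=
  Num.sqrt (inertia m z) * potential m z.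

Definition sqrt2IU (R : realType) (m : R) (z : 'rV[R]_8) : R :=
  Num.sqrt (2 * inertia m z) * potential m z.

Definition partial (R : realType) (i : 'I_8) (F : 'rV[R]_8 -> R) :
    'rV[R]_8 -> R :=
  'D_(delta_mx ord0 i) F.

Definition hessian (R : realType) (F : 'rV[R]_8 -> R) (z : 'rV[R]_8) :
    'M[R]_8 :=
  \matrix_(i, j) partial i (partial j F) z.

(* ['D_v F] is a total function with a default value where the limit does not
   exist; this says that no default value enters [hessian F z]. *)
Definition has_hessian (R : realType) (F : 'rV[R]_8 -> R) (z : 'rV[R]_8) :
    Prop :=
  (\forall w \near z, forall j : 'I_8, derivable F w (delta_mx ord0 j)) /\
  (forall i j : 'I_8, derivable (partial j F) z (delta_mx ord0 i)).

Definition critical_point (R : realType) (F : 'rV[R]_8 -> R)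
    (z : 'rV[R]_8) : Prop :=
  differentiable F z /\ forall v : 'rV[R]_8, 'd F z v = 0.

(* Collisions lie outside the domain of the potential; they are excluded
   explicitly because [0^-1 = 0]. *)
Definition collision_free (R : realType) (z : 'rV[R]_8) : Prop :=
  forall i j : 'I_4, i != j -> (xpos z i, ypos z i) <> (xpos z j, ypos z j).

Definition central_configuration (R : realType) (m : R) (z : 'rV[R]_8) :
    Prop :=
  [/\ 0 < m, collision_free z & critical_point (sqrtIU m) z].

(* [mup 0 (char_poly A)] is the multiplicity of 0 as an eigenvalue of [A]. *)
Definition degenerate_central_configuration (R : realType) (m : R)
    (z : 'rV[R]_8) : Prop :=
  [/\ central_configuration m z,
      has_hessian (sqrt2IU m) z
    & (2 < mup 0 (char_poly (hessian (sqrt2IU m) z)))%N].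

Definition z0 (R : realType) : 'rV[R]_8 :=
  \row_(k < 8) [:: 1; 0; - 2^-1; Num.sqrt 3 / 2;
                   - 2^-1; - (Num.sqrt 3 / 2); 0; 0]`_k.

Definition mstar (R : realType) : R :=
  (2 * Num.sqrt 3 + 9) / (18 * Num.sqrt 3 - 15).

(* Main.v *)
Require Import Defs.
From HB Require Import structures.
From mathcomp Require Import all_boot all_order all_algebra.
From mathcomp Require Import all_classical all_reals all_analysis.
From mathcomp Require Import ring lra.
Import Order.TTheory GRing.Theory Num.Theory.
Import numFieldNormedType.Exports.
Local Open Scope classical_set_scope.
Local Open Scope ring_scope.

(** The function [sqrt2IU m] is built by square roots, inverses, sums and
products from the quadratic forms [mass m z z] (which is 2I) and [sep i j z z]
(the squared mutual distances). Its first and second differentials are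
therefore closed expressions [grad] and [hess] in the polar forms of these
quadratic forms ([is_diff_sqrt2IU], [is_diff_grad]), valid at every
configuration without collisions, and [hess] evaluated on the canonical basis
is the Hessian matrix ([hessianE]). At [z0] all distances are sqrt 3 or 1 and
2I = 3; there [grad] vanishes ([grad_z0]), so [z0] is central.

The spectrum comes from the symmetry group S_3 of the triangle. Identify the
plane with the complex numbers and let w be a primitive cube root of unity, so
that [z0] is (1, w, w^2, 0). The space of configurations has the orthogonal
real basis consisting of
- [z0] and i [z0], the scaling and the rotation, which the Hessian kills;
- T(a) = (a, a, a, 0), S(a) = (0, 0, 0, a) and W(a) = (b, b/w, b/w^2, 0), where
  b is the conjugate of a, for a = 1 and for a = i.
Each of the families T, S, W carries the two-dimensional irreducible
representation of S_3, with the same action on the parameter a. By Schur's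
lemma the Hessian mixes the three families through one and the same 3 x 3
matrix [redhess m] for a = 1 and for a = i ([hess_basis]); its three eigenvalues
are the doubled ones, and the characteristic polynomial of the Hessian is
X^2 times the square of that of [redhess m] ([char_poly_hessian]).

Finally [det_redhess] shows that the determinant of [redhess m] is a positive
multiple, for m > 0, of 2 sqrt 3 + 9 - (18 sqrt 3 - 15) m, which vanishes
exactly at [mstar]. The two other eigenvalues are then the roots of X^2 - t X + c
with t the trace and c the sum of the principal 2 x 2 minors; bounds on sqrt 3
give c > 0 and t^2 > 4 c, so both are real and nonzero ([redhess_mstar]). *)

Set Implicit Arguments.
Unset Strict Implicit.
Unset Printing Implicit Defensive.

(** * Rules for differentials of real-valued functions *)

Section Differentials.
Context {R : realType} {V : normedModType R}.
Implicit Types (w v : V) (f g df dg : V -> R) (k : R).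

Lemma is_diff_cong w f df dg : is_diff w f df -> df =1 dg -> is_diff w f dg.
Proof. by move=> h /funext <-. Qed.

Lemma is_diff_ext w f g df dg :
  is_diff w f df -> f =1 g -> df =1 dg -> is_diff w g dg.
Proof. by move=> h /funext <- /funext <-. Qed.

(** The rules below restate those for sums, products and so on with bound
variables, so that applying them to an explicit function computes its
differential in readable form. *)
Lemma is_diff_add w f df g dg : is_diff w f df -> is_diff w g dg ->
  is_diff w (fun z => f z + g z) (fun v => df v + dg v).
Proof. by move=> hf hg; exact: is_diffD. Qed.

Lemma is_diff_sub w f df g dg : is_diff w f df -> is_diff w g dg ->
  is_diff w (fun z => f z - g z) (fun v => df v - dg v).
Proof. by move=> hf hg; exact: is_diffB. Qed.

Lemma is_diff_mul w f df g dg : is_diff w f df -> is_diff w g dg ->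
  is_diff w (fun z => f z * g z) (fun v => df v * g w + f w * dg v).
Proof.
move=> hf hg; apply: (is_diff_eq (is_diffM hf hg)); apply/funext => v /=.
by rewrite /GRing.scale /= addrC [df v * _]mulrC.
Qed.

Lemma is_diff_scale k w f df : is_diff w f df ->
  is_diff w (fun z => k * f z) (fun v => k * df v).
Proof. by move=> hf; exact: (is_diffZ k hf). Qed.

Lemma is_diff_scaler k w f df : is_diff w f df ->
  is_diff w (fun z => f z * k) (fun v => df v * k).
Proof.
by move=> /(is_diff_scale k) hf; apply: (is_diff_ext hf) => z; exact: mulrC.
Qed.

Lemma is_diff_inv w f df : f w != 0 -> is_diff w f df ->
  is_diff w (fun z => (f z)^-1) (fun v => - df v / f w ^+ 2).
Proof.
move=> fw0 [fd fE]; apply: DiffDef; first exact: differentiableV.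
rewrite diffV// fE; apply/funext => v /=.
by rewrite /GRing.scale /= mulrC mulrN mulNr.
Qed.

Lemma is_diff_sqrt w f df : 0 < f w -> is_diff w f df ->
  is_diff w (fun z => Num.sqrt (f z)) (fun v => df v / (2 * Num.sqrt (f w))).
Proof.
move=> fw0 dfw.
have [sd sE] := is_derive1_sqrt fw0.
have sdiff : differentiable (Num.sqrt : R -> R) (f w) by apply/derivable1_diffP.
have ds : is_diff (f w) (Num.sqrt : R -> R) (fun h => h / (2 * Num.sqrt (f w))).
  apply: DiffDef => //; apply/funext => h /=.
  by rewrite -[h in LHS]mulr1 [LHS]linearZ -deriveE// sE.
exact: (is_diff_comp dfw ds).
Qed.

Lemma is_diff_bigsum (I : Type) (r : seq I) (P : pred I) w (f df : I -> V -> R) :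
  (forall i, P i -> is_diff w (f i) (df i)) ->
  is_diff w (fun z => \sum_(i <- r | P i) f i z)
            (fun v => \sum_(i <- r | P i) df i v).
Proof.
move=> h; elim: r => [|i r ih].
  by apply: (is_diff_ext (is_diff_cst 0 w)) => z; rewrite big_nil.
case Pi: (P i).
  by apply: (is_diff_ext (is_diff_add (h i Pi) ih)) => z; rewrite big_cons Pi.
by apply: (is_diff_ext ih) => z; rewrite big_cons Pi.
Qed.

Lemma is_diff_derive w v f df : is_diff w f df -> is_derive w v f (df v).
Proof.
move=> [fd fE]; apply: DeriveDef; first exact: diff_derivable.
by rewrite deriveE// fE.
Qed.

End Differentials.

(** * The gradient and Hessian forms of the scaled potential *)

Section Forms.
Context {R : realType}.
Implicit Types (m : R) (u v w z : 'rV[R]_8) (i j : nat).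

Definition sep i j u v : R :=
  (xpos u i - xpos u j) * (xpos v i - xpos v j)
  + (ypos u i - ypos u j) * (ypos v i - ypos v j).

Definition mass m u v : R :=
  \sum_(i < 3) (xpos u i * xpos v i + ypos u i * ypos v i)
  + m * (xpos u 3 * xpos v 3 + ypos u 3 * ypos v 3).

Definition pairsum m (t : nat -> nat -> R) : R :=
  \sum_(i < 3) \sum_(j < 3 | (i < j)%N) t i j + m * \sum_(i < 3) t i 3.

Lemma massE m u v : mass m u v =
  xpos u 0 * xpos v 0 + ypos u 0 * ypos v 0
  + (xpos u 1 * xpos v 1 + ypos u 1 * ypos v 1)
  + (xpos u 2 * xpos v 2 + ypos u 2 * ypos v 2)
  + m * (xpos u 3 * xpos v 3 + ypos u 3 * ypos v 3).
Proof. by rewrite /mass !big_ord_recl big_ord0 /bump /= addr0 !addrA. Qed.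

Lemma pairsumE m t :
  pairsum m t = t 0 1 + t 0 2 + t 1 2 + m * (t 0 3 + t 1 3 + t 2 3).
Proof.
rewrite /pairsum.
do ![rewrite ?big_mkcond !big_ord_recl ?big_ord0 /= ?add0r ?addr0].
by rewrite /bump /= !addrA.
Qed.

Lemma sqrt2IUE m z : sqrt2IU m z
  = Num.sqrt (mass m z z) * pairsum m (fun i j => (Num.sqrt (sep i j z z))^-1).
Proof. by rewrite /sqrt2IU /inertia mulrA divff ?mul1r// pnatr_eq0. Qed.

Lemma sqrtIUE m z : sqrtIU m z = (Num.sqrt 2)^-1 * sqrt2IU m z.
Proof.
rewrite /sqrtIU /sqrt2IU (sqrtrM (inertia m z) (ler0n R 2)).
by rewrite !mulrA mulVf ?mul1r.
Qed.

Definition gradU m w v : R :=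
  pairsum m (fun i j => -1 * sep i j w v / Num.sqrt (sep i j w w) ^+ 3).

Definition hessU m w u v : R :=
  pairsum m (fun i j =>
    3 * sep i j w u * sep i j w v / Num.sqrt (sep i j w w) ^+ 5
    - sep i j u v / Num.sqrt (sep i j w w) ^+ 3).

Definition grad m w v : R :=
  mass m w v / Num.sqrt (mass m w w)
    * pairsum m (fun i j => (Num.sqrt (sep i j w w))^-1)
  + Num.sqrt (mass m w w) * gradU m w v.

Definition hess m w u v : R :=
  (mass m u v / Num.sqrt (mass m w w)
   - mass m w u * mass m w v / Num.sqrt (mass m w w) ^+ 3)
    * pairsum m (fun i j => (Num.sqrt (sep i j w w))^-1)
  + mass m w v / Num.sqrt (mass m w w) * gradU m w u
  + mass m w u / Num.sqrt (mass m w w) * gradU m w v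
  + Num.sqrt (mass m w w) * hessU m w u v.

Lemma is_diff_coord (k : 'I_8) w :
  is_diff w (fun z : 'rV[R]_8 => z ord0 k) (fun v : 'rV[R]_8 => v ord0 k).
Proof.
have cE v : 'D_v (fun z : 'rV[R]_8 => z ord0 k : R) w = v ord0 k.
  rewrite /derive; apply: lim_near_cst => //.
  near=> h; rewrite /= !mxE addrK /GRing.scale /= mulrA mulVf ?mul1r//.
  by near: h; exact: nbhs_dnbhs_neq.
have cd := @differentiable_coord _ _ _ w ord0 k.
by apply: DiffDef => //; apply/funext => v; rewrite -deriveE// cE.
Unshelve. all: by end_near. Qed.

Lemma is_diff_sep i j v w :
  is_diff w (fun z => sep i j z v) (fun u => sep i j u v).
Proof.
by apply: is_diff_add; apply: is_diff_scaler; apply: is_diff_sub;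
  apply: is_diff_coord.
Qed.

Lemma is_diff_sepxx i j w :
  is_diff w (fun z => sep i j z z) (fun v => 2 * sep i j w v).
Proof.
rewrite /sep; apply: is_diff_cong.
- by apply: is_diff_add; apply: is_diff_mul; apply: is_diff_sub;
    apply: is_diff_coord.
- by move=> u /=; rewrite /xpos /ypos; ring.
Qed.

Lemma is_diff_mass m v w :
  is_diff w (fun z => mass m z v) (fun u => mass m u v).
Proof.
apply: is_diff_add; last apply: is_diff_scale.
  apply: is_diff_bigsum => i _.
  by apply: is_diff_add; apply: is_diff_scaler; apply: is_diff_coord.
by apply: is_diff_add; apply: is_diff_scaler; apply: is_diff_coord.
Qed.

Lemma is_diff_massxx m w :
  is_diff w (fun z => mass m z z) (fun v => 2 * mass m w v).
Proof.
apply: is_diff_cong.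
- apply: is_diff_add; last apply: is_diff_scale.
  + by apply: is_diff_bigsum => i _;
      apply: is_diff_add; apply: is_diff_mul; apply: is_diff_coord.
  + by apply: is_diff_add; apply: is_diff_mul; apply: is_diff_coord.
- move=> u; rewrite /= /mass [RHS]mulrDr mulr_sumr; congr (_ + _).
    by apply: eq_bigr => i _; rewrite /xpos /ypos; ring.
  by rewrite /xpos /ypos; ring.
Qed.

Lemma is_diff_pairsum m w (f df : nat -> nat -> 'rV[R]_8 -> R) :
  (forall i j, (i < j < 4)%N -> is_diff w (f i j) (df i j)) ->
  is_diff w (fun z => pairsum m (fun i j => f i j z))
            (fun v => pairsum m (fun i j => df i j v)).
Proof.
move=> h; apply: is_diff_add; last apply: is_diff_scale.
  by do 2![apply: is_diff_bigsum => ? ?]; apply: h; apply/andP; split=> //;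
    apply: ltn_trans (ltn_ord _) _.
by apply: is_diff_bigsum => i _; apply: h; rewrite ltn_ord.
Qed.

(** The open set on which all the square roots involved are smooth. *)
Definition regular m w : Prop :=
  0 < mass m w w /\ forall i j, (i < j < 4)%N -> 0 < sep i j w w.

Lemma near_regular m w : regular m w -> \forall z \near w, regular m z.
Proof.
move=> [mp wp].
have pos (f df : 'rV[R]_8 -> R) :
    is_diff w f df -> 0 < f w -> \forall z \near w, 0 < f z.
  by move=> [/differentiable_continuous fc _]; exact: (cvgr_gt _ fc).
pose Q (i j : 'I_4) z := (i < j)%N -> 0 < sep i j z z.
have sep_pos : \forall z \near w, forall i j : 'I_4, Q i j z.
  refine (@filter_forall _ _
    (fun (i : 'I_4) z => forall j : 'I_4, Q i j z) (nbhs w) _ _) => i.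
  refine (@filter_forall _ _ (fun (j : 'I_4) z => Q i j z) (nbhs w) _ _) => j.
  rewrite /Q; case ij: (i < j)%N; last by near=> z.
  have ij4 : (i < j < 4)%N by rewrite ij ltn_ord.
  by apply: filterS (pos _ _ (is_diff_sepxx i j w) (wp i j ij4)).
near=> z; split; first by near: z; exact: (pos _ _ (is_diff_massxx m w)).
move=> i j /andP[ij j4].
have zQ : forall i j : 'I_4, Q i j z by near: z.
exact: (zQ (Ordinal (ltn_trans ij j4)) (Ordinal j4)).
Unshelve. all: by end_near. Qed.

Lemma is_diff_U m w : regular m w ->
  is_diff w (fun z => pairsum m (fun i j => (Num.sqrt (sep i j z z))^-1))
            (gradU m w).
Proof.
move=> [_ wp]; apply: is_diff_pairsum => i j ij.
have sp := wp i j ij.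
have r0 : Num.sqrt (sep i j w w) != 0 by rewrite sqrtr_eq0 -ltNge.
apply: is_diff_cong.
- by apply: is_diff_inv => //; apply: is_diff_sqrt => //; apply: is_diff_sepxx.
- by move=> v /=; field.
Qed.

Lemma is_diff_sqrt2IU m w : regular m w -> is_diff w (sqrt2IU m) (grad m w).
Proof.
move=> wr; have [mp _] := wr.
have r0 : Num.sqrt (mass m w w) != 0 by rewrite sqrtr_eq0 -ltNge.
rewrite (funext (sqrt2IUE m)).
apply: is_diff_cong.
- apply: is_diff_mul; last exact: is_diff_U wr.
  by apply: is_diff_sqrt => //; apply: is_diff_massxx.
- by move=> v /=; rewrite /grad; congr (_ * _ + _); field.
Qed.

Lemma is_diff_gradU m w v : regular m w ->
  is_diff w (fun z => gradU m z v) (fun u => hessU m w u v).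
Proof.
move=> [_ wp]; apply: is_diff_pairsum => i j ij.
have sp := wp i j ij.
have r0 : Num.sqrt (sep i j w w) != 0 by rewrite sqrtr_eq0 -ltNge.
apply: is_diff_cong.
- apply: is_diff_mul; last first.
    apply: is_diff_inv; first by rewrite expf_neq0.
    apply: is_diff_mul; last apply: is_diff_mul;
    by apply: is_diff_sqrt => //; apply: is_diff_sepxx.
  by apply: (is_diff_scale (-1)); apply: (is_diff_sep i j v).
- by move=> u /=; field.
Qed.

Lemma is_diff_grad m w v : regular m w ->
  is_diff w (fun z => grad m z v) (fun u => hess m w u v).
Proof.
move=> wr; have [mp _] := wr.
have r0 : Num.sqrt (mass m w w) != 0 by rewrite sqrtr_eq0 -ltNge.
have ds : is_diff w (fun z => Num.sqrt (mass m z z) : R)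
                    (fun u => mass m w u / Num.sqrt (mass m w w)).
  apply: is_diff_cong => [|].
    by apply: is_diff_sqrt => //; apply: is_diff_massxx.
  by move=> u /=; field.
apply: is_diff_cong.
- apply: is_diff_add; apply: is_diff_mul.
  + apply: is_diff_mul; first exact: (is_diff_mass m v).
    exact: (@is_diff_inv _ _ w (fun z => Num.sqrt (mass m z z)) _ r0 ds).
  + exact: is_diff_U wr.
  + exact: is_diff_gradU wr.
- by move=> u /=; rewrite /hess; field.
Qed.

Lemma partial_sqrt2IU m w (k : 'I_8) : regular m w ->
  partial k (sqrt2IU m) w = grad m w (delta_mx ord0 k).
Proof.
by move=> /is_diff_sqrt2IU/(is_diff_derive (delta_mx ord0 k)) h;
  exact: derive_val.
Qed.

(** The partial derivatives agree with [grad] on a whole neighbourhood, hence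
can be differentiated once more through [is_diff_grad]. *)
Lemma is_derive_partial m w (k l : 'I_8) : regular m w ->
  is_derive w (delta_mx ord0 k) (partial l (sqrt2IU m))
    (hess m w (delta_mx ord0 k) (delta_mx ord0 l)).
Proof.
move=> wr.
apply: (@near_eq_is_derive _ _ _ (fun z => grad m z (delta_mx ord0 l))).
  by apply: filterS (near_regular wr) => z zr; rewrite partial_sqrt2IU.
exact: is_diff_derive (is_diff_grad _ wr).
Qed.

Lemma hessianE m w : regular m w ->
  hessian (sqrt2IU m) w
  = \matrix_(k, l) hess m w (delta_mx ord0 k) (delta_mx ord0 l).
Proof.
move=> wr; apply/matrixP => k l; rewrite !mxE.
exact: (@derive_val _ _ _ _ _ _ _ (is_derive_partial k l wr)).
Qed.

Lemma has_hessian_sqrt2IU m w : regular m w -> has_hessian (sqrt2IU m) w.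
Proof.
move=> wr; split.
  apply: filterS (near_regular wr) => z zr j.
  by have [/diff_derivable] := is_diff_sqrt2IU zr.
by move=> i j; have [] := is_derive_partial i j wr.
Qed.

Lemma critical_sqrtIU m w : regular m w -> (forall v, grad m w v = 0) ->
  critical_point (sqrtIU m) w.
Proof.
move=> wr g0; rewrite (funext (sqrtIUE m)).
have [fd fE] := is_diff_scale (Num.sqrt 2)^-1 (is_diff_sqrt2IU wr).
by split=> // v; rewrite fE /= g0 mulr0.
Qed.

Lemma collision_free_regular m w : regular m w -> collision_free w.
Proof.
move=> [_ wp].
have distinct (i j : 'I_4) : (i < j)%N ->
    (xpos w i, ypos w i) <> (xpos w j, ypos w j).
  move=> ij [ex ey]; have := wp i j; rewrite ij ltn_ord => /(_ isT).
  by rewrite /sep ex ey !subrr !mulr0 addr0 ltxx.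
by move=> i j; rewrite neq_ltn => /orP[/distinct|/distinct/nesym].
Qed.

(** As the differential of [grad], the form [hess] is linear in its first
direction. *)
Lemma hess_linear m w v (I : finType) (a : I -> R) (u : I -> 'rV[R]_8) :
  regular m w -> hess m w (\sum_i a i *: u i) v = \sum_i a i * hess m w (u i) v.
Proof.
move=> wr; have [_ E] := is_diff_grad v wr.
have {}E x : hess m w x v = 'd (fun z => grad m z v) w x by rewrite E.
by rewrite E linear_sum; apply: eq_bigr => i _; rewrite linearZ E.
Qed.

(** With unit masses, the mass form is the Euclidean inner product. *)
Lemma mass1E u v : mass 1 u v = (u *m v^T) ord0 ord0.
Proof.
rewrite mxE (eq_bigr (fun j : 'I_8 => u ord0 (inord j) * v ord0 (inord j))).
  by rewrite massE !big_ord_recl big_ord0 /bump /= mul1r addr0 !addrA.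
by move=> j _; rewrite mxE inord_val.
Qed.

Lemma mass1_delta u (j : 'I_8) : mass 1 u (delta_mx ord0 j) = u ord0 j.
Proof. by rewrite mass1E trmx_delta -colE mxE. Qed.

End Forms.

(** * Characteristic polynomials of similar, block and 3 x 3 matrices *)

Section CharPoly.
Context {R : idomainType}.

Lemma char_poly_similar n (P A B : 'M[R]_n) :
  \det P != 0 -> P *m A = B *m P -> char_poly A = char_poly B.
Proof.
move=> P0 PAB; have P0' : \det (map_mx polyC P) != 0.
  by rewrite det_map_mx polyC_eq0.
apply: (mulfI P0'); rewrite [RHS]mulrC -!det_mulmx; congr (\det _).
by rewrite /char_poly_mx mulmxBr mulmxBl -!map_mxM PAB scalar_mxC.
Qed.

Lemma char_poly_block_diag n1 n2 (A : 'M[R]_n1) (D : 'M[R]_n2) :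
  char_poly (block_mx A 0 0 D) = char_poly A * char_poly D.
Proof.
rewrite /char_poly /char_poly_mx scalar_mx_block map_block_mx !map_mx0.
by rewrite opp_block_mx add_block_mx !oppr0 !addr0 det_ublock.
Qed.

Lemma char_poly0 n : char_poly (0 : 'M[R]_n) = 'X^n.
Proof. by rewrite /char_poly /char_poly_mx map_mx0 subr0 det_scalar. Qed.

Lemma det3 (S : comNzRingType) (A : 'M[S]_3) (a : nat -> nat -> S) :
  (forall i j : 'I_3, A i j = a i j) ->
  \det A = a 0 0 * (a 1 1 * a 2 2 - a 1 2 * a 2 1)
         - a 0 1 * (a 1 0 * a 2 2 - a 1 2 * a 2 0)
         + a 0 2 * (a 1 0 * a 2 1 - a 1 1 * a 2 0).
Proof.
move=> aE; rewrite (expand_det_row _ ord0) !big_ord_recl big_ord0 /cofactor.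
rewrite !(expand_det_row _ ord0) !big_ord_recl !big_ord0 /cofactor !det_mx11.
by rewrite !mxE !aE /= /bump /=; ring.
Qed.

(** The coefficients of the characteristic polynomial of a 3 x 3 matrix are, up
to sign, its trace, the sum of its principal 2 x 2 minors and its determinant;
x and y are the eigenvalues left over by the kernel. *)
Lemma char_poly3 (A : 'M[R]_3) (a : nat -> nat -> R) (x y : R) :
  (forall i j : 'I_3, A i j = a i j) -> \det A = 0 ->
  a 0 0 + a 1 1 + a 2 2 = x + y ->
  (a 0 0 * a 1 1 - a 0 1 * a 1 0) + (a 0 0 * a 2 2 - a 0 2 * a 2 0)
    + (a 1 1 * a 2 2 - a 1 2 * a 2 1) = x * y ->
  char_poly A = 'X * ('X - x%:P) * ('X - y%:P).
Proof.
move=> aE detA tr minors.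
pose b (i j : nat) := 'X *+ (i == j) - (a i j)%:P.
have bE (i j : 'I_3) : char_poly_mx A i j = b i j by rewrite !mxE aE.
rewrite /char_poly (det3 bE) /b /=.
have -> : 'X * ('X - x%:P) * ('X - y%:P)
   = 'X ^+ 3 - (x + y)%:P * 'X ^+ 2 + (x * y)%:P * 'X - (\det A)%:P :> {poly R}.
  by rewrite detA; ring.
by rewrite -tr -minors (det3 aE); ring.
Qed.

End CharPoly.

(** * The equilateral triangle with a central mass *)

Section Triangle.
Context {R : realType}.
Implicit Types (m : R) (u v : 'rV[R]_8) (i j : nat).
Local Notation s := (Num.sqrt 3 : R).

Lemma sqr_sqrt3 : s ^+ 2 = 3. Proof. by rewrite sqr_sqrtr. Qed.

Lemma sqrt3_gt0 : 0 < s. Proof. by rewrite sqrtr_gt0. Qed.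

Lemma sqrt3_neq0 : s != 0. Proof. by rewrite gt_eqF// sqrt3_gt0. Qed.

Lemma sqrt3_bounds : 173 / 100 < s < 174 / 100.
Proof.
have := sqrt3_gt0; have := sqr_sqrt3; set t := s => t2 t0.
by apply/andP; split; nra.
Qed.

Definition config (c : seq R) : 'rV[R]_8 := \row_k c`_k.

Lemma xpos_config c i : (i < 4)%N -> xpos (config c) i = c`_(2 * i).
Proof. by move=> i4; rewrite /xpos mxE inordK//; case: i i4 => [|[|[|[]]]]. Qed.

Lemma ypos_config c i : (i < 4)%N -> ypos (config c) i = c`_(2 * i + 1).
Proof. by move=> i4; rewrite /ypos mxE inordK//; case: i i4 => [|[|[|[]]]]. Qed.

(** In complex notation: [z0], i [z0], T(1), S(1), W(1), T(i), S(i), W(i), where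
T(a) = (a, a, a, 0), S(a) = (0, 0, 0, a) and W(a) = (b, b/w, b/w^2, 0) with b the
conjugate of a and w a primitive cube root of unity. *)
Definition basis : seq (seq R) :=
  [:: [:: 1; 0; - 2^-1; s / 2; - 2^-1; - (s / 2); 0; 0];
      [:: 0; 1; - (s / 2); - 2^-1; s / 2; - 2^-1; 0; 0];
      [:: 1; 0; 1; 0; 1; 0; 0; 0];
      [:: 0; 0; 0; 0; 0; 0; 1; 0];
      [:: 1; 0; - 2^-1; - (s / 2); - 2^-1; s / 2; 0; 0];
      [:: 0; 1; 0; 1; 0; 1; 0; 0];
      [:: 0; 0; 0; 0; 0; 0; 0; 1];
      [:: 0; -1; - (s / 2); 2^-1; s / 2; 2^-1; 0; 0]].

Definition basis_vec (k : nat) : 'rV[R]_8 := config (nth [::] basis k).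

Lemma z0E : z0 R = basis_vec 0.
Proof. by []. Qed.

Lemma sep_z0_vertices i j : (i < j < 3)%N -> sep i j (z0 R) (z0 R) = 3.
Proof.
rewrite z0E => /andP[ij j3].
case: j j3 ij => [|[|[|//]]] _; case: i => [|[|//]] //= _;
  by rewrite /sep !xpos_config// !ypos_config//=; field: sqr_sqrt3.
Qed.

Lemma sep_z0_centre i : (i < 3)%N -> sep i 3 (z0 R) (z0 R) = 1.
Proof.
rewrite z0E; case: i => [|[|[|i]]] //= _;
  by rewrite /sep !xpos_config// !ypos_config//=; field: sqr_sqrt3.
Qed.

Lemma sep_z0 i j : (i < j < 4)%N ->
  sep i j (z0 R) (z0 R) = if (j < 3)%N then 3 else 1.
Proof.
case: (ltnP j 3) => j3 /andP[ij j4]; first by rewrite sep_z0_vertices ?ij.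
have -> : j = 3%N by apply/eqP; rewrite eqn_leq -ltnS j4.
by rewrite sep_z0_centre//; apply: leq_trans ij _; rewrite -ltnS.
Qed.

Lemma dist_z0 i j : (i < j < 4)%N ->
  Num.sqrt (sep i j (z0 R) (z0 R)) = if (j < 3)%N then s else 1.
Proof. by move=> /sep_z0 ->; case: ifP => // _; rewrite sqrtr1. Qed.

Lemma mass_z0 m : mass m (z0 R) (z0 R) = 3.
Proof. by rewrite z0E massE !xpos_config// !ypos_config//=; field: sqr_sqrt3. Qed.

Lemma regular_z0 m : regular m (z0 R).
Proof.
by split=> [|i j /sep_z0 ->]; [rewrite mass_z0 | case: ifP].
Qed.

(** The total attraction on each vertex points to the centre, with the same
strength at all three vertices, and the attractions on the central body
cancel, so the force is a multiple of the gradient of the moment of inertia. *)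
Lemma grad_z0 m v : grad m (z0 R) v = 0.
Proof.
have s0 := sqrt3_neq0.
rewrite /grad /gradU !pairsumE !dist_z0//= mass_z0 massE.
by rewrite /sep z0E !xpos_config// !ypos_config//=; field: sqr_sqrt3.
Qed.

(** Scaling and rotating [z0] produces critical points only, so the two tangent
directions [z0] and i [z0] lie in the kernel. *)
Lemma hess_basis0 m k v : (k < 2)%N -> hess m (z0 R) (basis_vec k) v = 0.
Proof.
have s0 := sqrt3_neq0.
case: k => [|[|k]] // _;
  rewrite /hess /gradU /hessU !pairsumE !dist_z0//= mass_z0 !massE;
  by rewrite /sep z0E !xpos_config// !ypos_config//=; field: sqr_sqrt3.
Qed.

Definition redhess_entry m : nat -> nat -> R :=
  let f := s * m in
  fun i j => (nth [::]
    [:: [:: 1 + 3 / 2 * f; - (3 / 2) * f; 3 / 2 * f];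
        [:: - 2^-1 * f; m + f * m + 3 / 2 * f; - (3 / 2) * f];
        [:: 3 / 2 * f; - (9 / 2) * f; 3 / 2 + 3 / 2 * f]] i)`_j.

(** Row k holds the coordinates, in the basis T, S, W, of the image under the
Hessian of the k-th of these vectors. It is not symmetric because T and W have
squared length 3 while S has length 1. *)
Definition redhess m : 'M[R]_3 := \matrix_(k < 3, l < 3) redhess_entry m k l.

(** Offset 2 selects the real parameter a = 1, offset 5 the parameter a = i; the
coefficients are the same because T, S and W are equivariant in a. *)
Lemma hess_basis m d (k : 'I_3) v : d \in [:: 2; 5]%N ->
  hess m (z0 R) (basis_vec (d + k)) v
  = \sum_(l < 3) redhess m k l * mass 1 (basis_vec (d + l)) v.
Proof.
have s0 := sqrt3_neq0.
rewrite !inE => /orP[] /eqP->; case: k => [[|[|[|//]]]] /= ?;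
  rewrite !big_ord_recl big_ord0 !mxE /redhess_entry /=
    /hess /gradU /hessU !pairsumE !dist_z0//= mass_z0 !massE;
  by rewrite /sep z0E !xpos_config// !ypos_config//=; field: sqr_sqrt3.
Qed.

Definition basis_mx d n : 'M[R]_(n, 8) := \matrix_(k < n) basis_vec (d + k).

Lemma basis_mx_split d n1 n2 :
  basis_mx d (n1 + n2) = col_mx (basis_mx d n1) (basis_mx (d + n1) n2).
Proof.
apply/row_matrixP => k; rewrite rowK; case: (split_ordP k) => l ->.
  by rewrite rowKu rowK.
by rewrite rowKd rowK /= addnA.
Qed.

Lemma basis_mx_hessian m d n (k : 'I_n) (j : 'I_8) :
  (basis_mx d n *m hessian (sqrt2IU m) (z0 R)) k j
  = hess m (z0 R) (basis_vec (d + k)) (delta_mx ord0 j).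
Proof.
rewrite hessianE; last exact: regular_z0.
rewrite [basis_vec _]row_sum_delta (hess_linear _ _ _ (regular_z0 m)) [LHS]mxE.
by apply: eq_bigr => i _; rewrite !mxE.
Qed.

Definition block_hessian m : 'M[R]_(2 + (3 + 3)) :=
  block_mx 0 0 0 (block_mx (redhess m) 0 0 (redhess m)).

Lemma hessian_block_hessian m :
  basis_mx 0 8 *m hessian (sqrt2IU m) (z0 R) = block_hessian m *m basis_mx 0 8.
Proof.
have P0 : basis_mx 0 2 *m hessian (sqrt2IU m) (z0 R) = 0.
  by apply/matrixP => k j; rewrite basis_mx_hessian hess_basis0 ?mxE ?ltn_ord.
have P3 d : d \in [:: 2; 5]%N ->
    basis_mx d 3 *m hessian (sqrt2IU m) (z0 R) = redhess m *m basis_mx d 3.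
  move=> d25; apply/matrixP => k j; rewrite basis_mx_hessian hess_basis// mxE.
  by apply: eq_bigr => l _; rewrite mass1_delta [basis_mx _ _ _ _]mxE.
rewrite (basis_mx_split 0 2 (3 + 3)) (basis_mx_split 2 3 3) /block_hessian.
rewrite !mul_block_col (@mul_col_mx _ 2 (3 + 3)) (@mul_col_mx _ 3 3) P0 !P3//.
by rewrite !mul0mx !addr0 !add0r.
Qed.

(** The basis is orthogonal, with nonzero squared lengths 3 and 1. *)
Lemma det_basis_mx : \det (basis_mx 0 8) != 0.
Proof.
pose d : seq R := [:: 3; 3; 3; 1; 3; 3; 1; 3].
have : basis_mx 0 8 *m (basis_mx 0 8)^T = diag_mx (\row_k d`_k).
  apply/row_matrixP => k; apply/rowP => l.
  have -> : row k (basis_mx 0 8 *m (basis_mx 0 8)^T) ord0 l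
      = mass 1 (basis_vec k) (basis_vec l).
    by rewrite mass1E !mxE; apply: eq_bigr => j _; rewrite !mxE.
  rewrite !mxE -val_eqE massE.
  case: k l => k /= k8 [l /= l8].
  (* one goal for each of the 64 pairs of basis vectors *)
  do 8![case: k k8 => [_|k k8];
    [do 8![case: l l8 => [_|l l8];
     [by rewrite !xpos_config// !ypos_config//= ?mulr1n ?mulr0n;
         field: sqr_sqrt3|]]; by []|]].
  by [].
move=> /(congr1 determinant); rewrite det_mulmx det_tr det_diag => detE.
apply: contraTneq isT => d0; move: detE; rewrite d0 mul0r => /esym/eqP.
rewrite prodf_seq_eq0 => /hasP[k _ /=]; rewrite mxE.
by case: k => [[|[|[|[|[|[|[|[|]]]]]]]] //= _];
  rewrite /d /= ?pnatr_eq0 ?oner_eq0.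
Qed.

Lemma char_poly_hessian m :
  char_poly (hessian (sqrt2IU m) (z0 R)) = 'X^2 * (char_poly (redhess m) ^+ 2).
Proof.
rewrite (char_poly_similar det_basis_mx (hessian_block_hessian m)).
by rewrite (@char_poly_block_diag _ 2 (3 + 3)) char_poly_block_diag char_poly0.
Qed.

(** * The degenerate mass *)

(** The last factor is linear in m, which singles out [mstar] as the only
positive mass for which [redhess m] is singular. *)
Lemma det_redhess m : \det (redhess m)
  = s / 4 * m * (1 + s * m) * (2 * s + 9 - (18 * s - 15) * m).
Proof.
have aE (i j : 'I_3) : redhess m i j = redhess_entry m i j by rewrite mxE.
by rewrite (det3 aE) /redhess_entry /=; field: sqr_sqrt3.
Qed.

Lemma mstar_denom_neq0 : 18 * s - 15 != 0.
Proof. by have /andP[lo _] := sqrt3_bounds; rewrite gt_eqF//; lra. Qed.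

Lemma mstarE : mstar R = (81 + 64 * s) / 249.
Proof.
by have d0 := mstar_denom_neq0; rewrite /mstar; field: sqr_sqrt3.
Qed.

Lemma mstar_gt0 : 0 < mstar R.
Proof. by rewrite mstarE divr_gt0// addr_gt0// mulr_gt0// sqrt3_gt0. Qed.

Lemma redhess_mstar : exists x y : R,
  [/\ x != 0, y != 0
    & char_poly (redhess (mstar R)) = 'X * ('X - x%:P) * ('X - y%:P)].
Proof.
pose m := mstar R; pose f := s * m; pose a := redhess_entry m.
have aE (i j : 'I_3) : redhess m i j = a i j by rewrite mxE.
have det0 : \det (redhess m) = 0.
  rewrite det_redhess /m /mstar [(18 * s - 15) * _]mulrC.
  by rewrite divfK ?mstar_denom_neq0// subrr mulr0.
(* trace and sum of the principal minors *)
pose t := 5 / 2 + 9 / 2 * f + m + f * m.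
pose c := 3 / 2 + 15 / 2 * f - 3 * f ^+ 2 + 5 / 2 * m + 11 / 2 * f * m
          + 3 * f ^+ 2 * m.
have tE : a 0 0 + a 1 1 + a 2 2 = t.
  by rewrite /a /redhess_entry /= -/f /t; field.
have cE : (a 0 0 * a 1 1 - a 0 1 * a 1 0) + (a 0 0 * a 2 2 - a 0 2 * a 2 0)
    + (a 1 1 * a 2 2 - a 1 2 * a 2 1) = c.
  by rewrite /a /redhess_entry /= -/f /c; field.
(* numerically m is about 0.7705, f 1.3345, t 10.30 and c 17.86 *)
have mE : m = (81 + 64 * s) / 249 := mstarE.
have fE : f = (64 + 27 * s) / 83 by rewrite /f mE; field: sqr_sqrt3.
have /andP[s_lo s_hi] := sqrt3_bounds.
have m_lo : 76 / 100 < m by rewrite mE; lra.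
have m_hi : m < 78 / 100 by rewrite mE; lra.
have f_lo : 133 / 100 < f by rewrite fE; lra.
have f_hi : f < 134 / 100 by rewrite fE; lra.
have c_gt0 : 0 < c by rewrite /c; nra.
have t_lo : 10 < t by rewrite /t; nra.
have c_hi : c < 25 by rewrite /c; nra.
have d_ge0 : 0 <= t ^+ 2 - 4 * c by nra.
pose r := Num.sqrt (t ^+ 2 - 4 * c).
have r2 : r ^+ 2 = t ^+ 2 - 4 * c by rewrite sqr_sqrtr.
pose x := (t + r) / 2; pose y := (t - r) / 2.
have xyc : c = x * y by rewrite /x /y; field: r2.
exists x, y.
have : x * y != 0 by rewrite -xyc gt_eqF.
rewrite mulf_eq0 negb_or => /andP[x0 y0]; split => //.
apply: (char_poly3 aE det0); last by rewrite cE.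
by rewrite tE /x /y; field.
Qed.

End Triangle.

Theorem mainTheorem3 (R : realType) :
  (exists l3 l4 l5 : R,
     char_poly (hessian (sqrt2IU (mstar R)) (z0 R))
       = \prod_(l <- [:: 0; 0; l3; l3; l4; l4; l5; l5]) ('X - l%:P)
     /\ count (fun l : R => l == 0) [:: l3; l4; l5] = 1%N)
  /\ degenerate_central_configuration (mstar R) (z0 R).
Proof.
have [x [y [x0 y0 redE]]] := @redhess_mstar R.
have charE : char_poly (hessian (sqrt2IU (mstar R)) (z0 R))
    = \prod_(l <- [:: 0; 0; 0; 0; x; x; y; y]) ('X - l%:P).
  rewrite char_poly_hessian redE !big_cons big_nil.
  by rewrite polyC0 subr0; ring.
split.
  exists 0, x, y; split; first exact: charE.
  by rewrite /= eqxx (negbTE x0) (negbTE y0).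
have z0r := @regular_z0 R (mstar R).
split.
- split; first exact: mstar_gt0.
  + exact: (collision_free_regular z0r).
  + exact: (critical_sqrtIU z0r (@grad_z0 R _)).
- exact: has_hessian_sqrt2IU.
- by rewrite charE mu_prod_XsubC /= eqxx.
Qed.
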